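(* Let $\kappa,\lambda$ be partitions and $N=|\kappa|+|\lambda|$. There is a polynomial $B(k)$ (depending on $\kappa,\lambda$), of degree at most $2N$, such that for every integer $k\ge1$ for which both $\kappa$ and $\lambda$ fit inside the $k\times k$ square and $k^2\ge N$, \[ \dim\big(\lambda,\widetilde{\kappa}^{(k)}\big)=\dim\big(\kappa,\widetilde{\lambda}^{(k)}\big)=\frac{g_k\,B(k)}{k^2(k^2-1)\cdots(k^2-N+1)},\qquad g_k=(k^2)!\prod_{j=0}^{k-1}\frac{j!}{(j+k)!}. \]
   Context: For partitions $\mu,\nu$, $\dim(\mu,\nu)$ is the number of sequences $\mu=\mu^0\subset\mu^1\subset\cdots\subset\mu^m=\nu$ of Young diagrams each obtained from the previous by adding one box (the number of standard tableaux of skew shape $\nu/\mu$; $0$ if $\mu\not\subseteq\nu$). A partition $\kappa$ fits in the $k\times k$ square if $\ell(\kappa)\le k$ and $\kappa_1\le k$; then $\widetilde{\kappa}^{(k)}$ denotes the partition whose conjugate has parts $(k-\kappa_k,\dots,k-\kappa_1)$ (with $\kappa$ padded by zeros to length $k$), i.e. the complement of $\kappa$ in the $k\times k$ square rotated by $180^\circ$ and conjugated; $|\widetilde{\kappa}^{(k)}|=k^2-|\kappa|$. *)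

(* Defs.v *)
From mathcomp Require Import all_boot all_order all_algebra.

Set Implicit Arguments.
Unset Strict Implicit.
Unset Printing Implicit Defensive.

Import GRing.Theory.

(* Partitions are weakly decreasing lists of positive parts, so that [size] is
   the length, [sumn] the weight, and [nth 0 mu] pads by zeros. *)
Definition is_part (mu : seq nat) : bool := sorted geq mu && (0 \notin mu).

(* [covers mu] lists the partitions obtained from [mu] by adding one box; the
   box is added at the end of row [i]. Rows past [size mu] cannot give a
   partition, see [coversP]. *)
Definition covers (mu : seq nat) : seq (seq nat) :=
  [seq nu <- [seq incr_nth mu i | i <- iota 0 (size mu).+1] | is_part nu].

Definition add_box : rel (seq nat) := fun mu nu => nu \in covers mu.

Lemma coversP mu nu :
  reflect (is_part nu /\ exists i, nu = incr_nth mu i) (add_box mu nu).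
Proof.
apply: (iffP idP) => [|[pnu [i def_nu]]].
  by rewrite /add_box mem_filter => /andP[-> /mapP[i _ ->]]; split=> //; exists i.
rewrite /add_box mem_filter pnu def_nu map_f // mem_iota /= add0n ltnS leqNgt.
apply/negP => lt_mu_i; case/andP: pnu => _ /negP; apply.
have lt_sz : size mu < size nu.
  by rewrite def_nu size_incr_nth [i < _]ltnNge (ltnW lt_mu_i) ltnS ltnW.
suff <- : nth 0 nu (size mu) = 0 by exact: mem_nth.
by rewrite def_nu nth_incr_nth nth_default // gtn_eqF.
Qed.

(* All (mu^1, ..., mu^m) such that mu, mu^1, ..., mu^m successively differ by
   the addition of one box. *)
Fixpoint box_paths (m : nat) (mu : seq nat) : seq (seq (seq nat)) :=
  if m is m'.+1 then [seq nu :: c | nu <- covers mu, c <- box_paths m' nu]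
  else [:: [::]].

(* A path from mu to nu necessarily has |nu| - |mu| steps; [dim_partE] shows
   that this counts all the paths from mu to nu, of any length. *)
Definition dim_part (mu nu : seq nat) : nat :=
  count (fun c => last mu c == nu) (box_paths (sumn nu - sumn mu) mu).

Lemma mem_box_paths m mu c :
  (c \in box_paths m mu) = (size c == m) && path add_box mu c.
Proof.
elim: m mu c => [|m IHm] mu [|nu c] //=.
  by apply/idP => /allpairsPdep[x [y [_ _]]].
apply/allpairsPdep/and3P => [[x [y [mu_x]]]|[sz_c mu_nu p_c]].
  by rewrite IHm => /andP[/eqP <- p_y] [-> ->]; split.
by exists nu, c; split=> //; rewrite IHm p_c andbT -eqSS.
Qed.

Lemma uniq_covers mu : uniq (covers mu).
Proof.
by rewrite filter_uniq // (map_inj_uniq (@incr_nth_inj mu)) iota_uniq.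
Qed.

Lemma uniq_box_paths m mu : uniq (box_paths m mu).
Proof.
elim: m mu => [|m IHm] mu //=; apply: allpairs_uniq_dep => //.
  exact: uniq_covers.
by move=> [x y] [x' y'] _ _ /= [-> ->].
Qed.

Lemma sumn_incr_nth mu i : sumn (incr_nth mu i) = (sumn mu).+1.
Proof.
elim: mu i => [|p mu IHmu] [|i] //=; last by rewrite IHmu addnS.
by elim: i => //= i; rewrite add0n.
Qed.

Lemma sumn_path_add_box mu c :
  path add_box mu c -> sumn (last mu c) = sumn mu + size c.
Proof.
elim: c mu => [|nu c IHc] mu /=; first by rewrite addn0.
case/andP=> /coversP[_ [i def_nu]] /IHc->.
by rewrite def_nu sumn_incr_nth addSnnS.
Qed.

Lemma dim_partE mu nu (s : seq (seq (seq nat))) :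
  uniq s -> (forall c, (c \in s) = path add_box mu c && (last mu c == nu)) ->
  dim_part mu nu = size s.
Proof.
move=> uniq_s mem_s; rewrite /dim_part -size_filter.
apply/perm_size/uniq_perm; rewrite ?filter_uniq ?uniq_box_paths // => c.
rewrite mem_filter mem_box_paths mem_s.
apply/and3P/andP => [[-> _ ->]|[p_c last_c]] //; split=> //.
by rewrite -(eqP last_c) (sumn_path_add_box p_c) addKn.
Qed.

(* Also valid for lists with trailing zeros. *)
Definition conj_part (mu : seq nat) : seq nat :=
  mkseq (fun j => count (fun p => j < p) mu) (head 0 mu).

Definition fits_square (k : nat) (kappa : seq nat) : bool :=
  (size kappa <= k) && (head 0 kappa <= k).

(* The nonzero parts among k - kappa_k, ..., k - kappa_1. *)
Definition square_compl (k : nat) (kappa : seq nat) : seq nat :=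
  [seq p <- mkseq (fun i => k - nth 0 kappa (k - i.+1)) k | 0 < p].

Definition tilde_part (k : nat) (kappa : seq nat) : seq nat :=
  conj_part (square_compl k kappa).

Local Open Scope ring_scope.

Definition g_square (k : nat) : rat :=
  ((k ^ 2)%N`!)%:R * \prod_(0 <= j < k) (j`!%:R / (j + k)%N`!%:R).

(* Main.v *)
(* Encode a partition mu with at most k rows by its beads mu_i + k - i. The tilde
   of kappa in the square has as beads the complement in {0, ..., 2k - 1} of the
   beads of kappa, and adding a box moves one bead up by one; so the tilde
   reverses paths, which gives the symmetry of the two dimensions.
   Aitken's formula writes dim(lambda, mu) as a determinant of falling factorials
   f_j(l_i), with l_i the beads of mu. Reducing the f_j modulo
   Q = prod_i (X - l_i), the ratio of dim(lambda, mu) to dim(0, mu) becomes a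
   determinant of size l(lambda) whose entries are coefficients at infinity of
   X^a f_j / Q. For mu the tilde of kappa, Q is prod_(r < 2k) (X - r) divided by
   the product over the beads of kappa, so that an s-th coefficient at infinity is
   a polynomial in k of degree at most 2s. The ratio is thus polynomial of degree
   at most 2|lambda|. Using symmetry and then the same ratio with the roles
   exchanged, dim(0, tilde of kappa) = dim(kappa, square) contributes g_k times a
   polynomial of degree at most 2|kappa|. *)
Require Import Defs.
From mathcomp Require Import all_boot all_order all_algebra all_fingroup.
From mathcomp Require Import zify ring.

Set Implicit Arguments.
Unset Strict Implicit.
Unset Printing Implicit Defensive.

Import GRing.Theory Num.Theory.

(** * Partitions and the branching recursion *)

Lemma part_nth_le mu i j : is_part mu -> i <= j -> nth 0 mu j <= nth 0 mu i.
Proof.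
case/andP=> mu_sorted _ leij.
have [lt_j|] := ltnP j (size mu); last by move=> ?; rewrite nth_default.
have geq_trans : transitive geq by move=> y x z /= leyx lezy; exact: leq_trans leyx.
by apply: (sorted_leq_nth geq_trans _ 0 mu_sorted); rewrite ?inE //;
   [exact: leqnn | exact: leq_ltn_trans lt_j].
Qed.

Lemma part_nth_gt0 mu i : is_part mu -> (0 < nth 0 mu i) = (i < size mu).
Proof.
case/andP=> _ mu0; have [lt_i|?] := ltnP i (size mu); last by rewrite nth_default.
by rewrite lt0n; apply: contraNneq mu0 => <-; rewrite mem_nth.
Qed.

Lemma part_eq mu nu : is_part mu -> is_part nu -> nth 0 mu =1 nth 0 nu -> mu = nu.
Proof.
move=> pmu pnu eq_nth; apply: (@eq_from_nth _ 0) => [|i _]; last exact: eq_nth.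
apply/eqP; rewrite eqn_leq; apply/andP; split; rewrite leqNgt -part_nth_gt0 //.
  by rewrite eq_nth nth_default.
by rewrite -eq_nth nth_default.
Qed.

Lemma part_from_nth mu : (forall i, nth 0 mu i.+1 <= nth 0 mu i) ->
  (forall i, i < size mu -> 0 < nth 0 mu i) -> is_part mu.
Proof.
move=> mu_le mu_gt0; apply/andP; split; first by apply/(sortedP 0) => i _; exact: mu_le.
by apply/negP => /(nthP 0)[i /mu_gt0 + mu_i]; rewrite mu_i.
Qed.

Lemma part_incr mu i : is_part mu -> (i == 0) || (nth 0 mu i < nth 0 mu i.-1) ->
  is_part (incr_nth mu i).
Proof.
move=> pmu lt_i; apply: part_from_nth => j.
  rewrite !nth_incr_nth; have := part_nth_le pmu (leqnSn j).
  case: (i =P j.+1) lt_i => [-> /=|_ _]; first by rewrite gtn_eqF //; lia.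
  by rewrite add0n => /leq_trans-> //; rewrite leq_addl.
have le_i : i <= size mu.
  case: i lt_i => // i /= lt_i; rewrite -part_nth_gt0 //; exact: leq_ltn_trans lt_i.
rewrite size_incr_nth nth_incr_nth; have := part_nth_gt0 j pmu.
by case: (i =P j) => /=; case: (ltnP i (size mu)); lia.
Qed.

Lemma part_incr_max mu i : is_part (incr_nth mu i) -> i <= size mu.
Proof.
move=> pmu; rewrite leqNgt; apply/negP => lt_i.
have := part_nth_gt0 (size mu) pmu; rewrite size_incr_nth [i < _]ltnNge (ltnW lt_i) /= ltnS (ltnW lt_i).
by rewrite nth_incr_nth nth_default // gtn_eqF.
Qed.

Lemma size_path_add_box mu c : path add_box mu c -> size mu <= size (last mu c).
Proof.
elim: c mu => //= nu c IHc mu /andP[/coversP[_ [i def_nu]] /IHc]; apply: leq_trans.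
by rewrite def_nu size_incr_nth; case: ltnP => // /leqW.
Qed.

Lemma dim_part_size mu nu : size nu < size mu -> dim_part mu nu = 0.
Proof.
move=> lt_nu; rewrite (@dim_partE _ _ [::]) // => c; symmetry; apply/negP => /andP[].
by move=> /size_path_add_box + /eqP last_c; rewrite last_c leqNgt lt_nu.
Qed.

Lemma dim_part_eq_sumn mu nu : sumn mu = sumn nu -> dim_part mu nu = (mu == nu).
Proof. by move=> eq_sum; rewrite /dim_part eq_sum subnn /= addn0. Qed.

Lemma dim_part_rec mu nu : sumn mu < sumn nu ->
  dim_part mu nu = \sum_(la <- covers mu) dim_part la nu.
Proof.
move=> lt_mu; rewrite {1}/dim_part -(subnSK lt_mu) /=.
rewrite count_flatten sumnE !big_map big_seq [RHS]big_seq.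
apply: eq_bigr => la; rewrite mem_filter => /andP[_ /mapP[i _ ->]].
by rewrite count_map /dim_part sumn_incr_nth.
Qed.

(** Rows past [size mu] never give a partition, so the index set may be enlarged; branching sums can
    then run over one fixed range. *)
Lemma big_covers (R : Type) (idx : R) (op : Monoid.law idx) mu n (F : seq nat -> R) :
  size mu < n ->
  \big[op/idx]_(la <- covers mu) F la =
  \big[op/idx]_(i < n | is_part (incr_nth mu i)) F (incr_nth mu i).
Proof.
move=> lt_n; rewrite big_filter big_map.
rewrite -(big_mkord (fun i => is_part (incr_nth mu i)) (fun i => F (incr_nth mu i))).
rewrite (big_cat_nat (leq0n _) lt_n) /= [X in op _ X]big_nat_cond [X in op _ X]big1 ?Monoid.mulm1 //.
by move=> i /andP[/andP[lt_i _]] /part_incr_max; rewrite leqNgt lt_i.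
Qed.

Lemma head_nth (s : seq nat) : head 0 s = nth 0 s 0.
Proof. by case: s. Qed.

(** * The tilde involution *)

Lemma leq_from_lt m n : (forall r, r < m -> r < n) -> m <= n.
Proof. by case: m => // m; apply. Qed.

Lemma eq_from_lt m n : (forall r, (r < m) = (r < n)) -> m = n.
Proof. by move=> eq_lt; apply/eqP; rewrite eqn_leq !leq_from_lt // => r; rewrite eq_lt. Qed.

Lemma lt_count_iota (P : pred nat) k r :
  (forall i j, i <= j -> P j -> P i) -> (r < count P (iota 0 k)) = (r < k) && P r.
Proof.
move=> P_down.
suff [t [tk -> Pt]] : exists t, [/\ t <= k, count P (iota 0 k) = t &
    forall i, i < k -> P i = (i < t)].
  by have [/Pt->//|] := ltnP r k; lia.
elim: k => [|k [t [tk cnt Pt]]]; first by exists 0.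
rewrite -addn1 iotaD count_cat cnt /= add0n addn0.
have [Pk|nPk] := boolP (P k); last first.
  exists t; split=> [||i]; rewrite ?addn0 //; first lia.
  rewrite addn1 ltnS leq_eqVlt => /orP[/eqP->|/Pt//].
  by rewrite (negPf nPk); lia.
suff def_t : t = k.
  exists k.+1; split=> [||i]; rewrite ?addn1 ?def_t // => lt_i.
  by rewrite lt_i (P_down i k).
apply/eqP; rewrite eqn_leq tk leqNgt; apply/negP => lt_tk.
by have := Pt t lt_tk; rewrite ltnn (P_down t k) // ltnW.
Qed.

Section Tilde.

Variable k : nat.
Implicit Types mu nu : seq nat.

Lemma fits_nth mu : is_part mu -> fits_square k mu -> forall i, nth 0 mu i <= k.
Proof.
move=> pmu /andP[_]; rewrite head_nth => le_k i.
exact: leq_trans (part_nth_le pmu (leq0n i)) le_k.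
Qed.

Lemma fits_nth0 mu : fits_square k mu -> forall i, k <= i -> nth 0 mu i = 0.
Proof. by move=> /andP[le_k _] i le_i; rewrite nth_default // (leq_trans le_k). Qed.

Lemma head_square_compl mu p : is_part mu -> p \in square_compl k mu ->
  p <= head 0 (square_compl k mu).
Proof.
move=> pmu; rewrite /square_compl => s_p.
have : sorted geq [seq p <- mkseq (fun i => k - nth 0 mu (k - i.+1)) k | 0 < p].
  have geq_trans : transitive geq by move=> y x z /= leyx lezy; exact: leq_trans leyx.
  apply: (sorted_filter geq_trans); apply/(sortedP 0) => i.
  rewrite size_mkseq => lt_i; rewrite !nth_mkseq ?(ltnW lt_i) //=.
  by apply/leq_sub2l/part_nth_le => //; lia.
case: filter s_p => //= q s; rewrite inE => /predU1P[-> //|s_p].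
by rewrite path_sortedE => [/andP[/allP/(_ p s_p)]|y x z /= leyx lezy] //; exact: leq_trans leyx.
Qed.

(* The box [(j, r)] is in the tilde of [mu] iff its reflection in the
   antidiagonal of the square is not in [mu]. *)
Lemma lt_nth_tilde mu j r : is_part mu ->
  (r < nth 0 (tilde_part k mu) j) = (r < k) && (j < k - nth 0 mu (k - r.+1)).
Proof.
move=> pmu; rewrite -(@lt_count_iota (fun i => j < k - nth 0 mu (k - i.+1))); last first.
  move=> a b leab /leq_trans; apply; apply/leq_sub2l/part_nth_le => //; lia.
congr (r < _).
transitivity (count (fun p => j < p) (square_compl k mu)); last first.
  rewrite count_filter count_map; apply: eq_count => i /=.
  by case: ltnP => //= lt_j; lia.
rewrite /tilde_part /conj_part; have [lt_j|le_j] := ltnP j (head 0 (square_compl k mu)).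
  by rewrite nth_mkseq.
rewrite nth_default ?size_mkseq //; symmetry; apply/eqP; rewrite -leqn0 leqNgt -has_count.
by apply/hasP => -[p /head_square_compl-/(_ pmu) le_p]; lia.
Qed.

Lemma tilde_is_part mu : is_part mu -> is_part (tilde_part k mu).
Proof.
move=> pmu; apply: part_from_nth => i.
  by apply: leq_from_lt => r; rewrite !lt_nth_tilde //; lia.
rewrite size_mkseq => lt_i; rewrite nth_mkseq // -has_count.
apply/hasP; exists (head 0 (square_compl k mu)) => //.
by move: lt_i; case: square_compl => //= p s _; rewrite mem_head.
Qed.

Lemma tilde_fits mu : is_part mu -> fits_square k (tilde_part k mu).
Proof.
move=> pmu; apply/andP; split; first rewrite leqNgt.
  by rewrite -part_nth_gt0 ?tilde_is_part // lt_nth_tilde //; lia.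
by rewrite head_nth; apply: leq_from_lt => r; rewrite lt_nth_tilde // => /andP[].
Qed.

Lemma tildeK mu : is_part mu -> fits_square k mu -> tilde_part k (tilde_part k mu) = mu.
Proof.
move=> pmu fmu; apply: part_eq => // [|j]; first by rewrite !tilde_is_part.
apply: eq_from_lt => r; rewrite lt_nth_tilde ?tilde_is_part //.
have /= lek := fits_nth pmu fmu j.
have [lt_r|le_r] := ltnP r k; last by lia.
have [lt_j|le_j] := ltnP j k; last by rewrite (fits_nth0 fmu le_j); lia.
have := lt_nth_tilde (k - r.+1) (k - j.+1) pmu.
by rewrite (_ : k - (k - j.+1).+1 = j); lia.
Qed.

(** The new box [(i, mu_i)] reflects to the box in row [a = k - mu_i - 1] and column [k - i - 1],
    the only box that the tilde of [nu] loses. *)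
Lemma tilde_add_box mu nu : is_part mu -> fits_square k nu -> add_box mu nu ->
  add_box (tilde_part k nu) (tilde_part k mu).
Proof.
move=> pmu fnu /coversP[pnu [i def_nu]]; set a := k - (nth 0 mu i).+1.
have nth_nu j : nth 0 nu j = (i == j) + nth 0 mu j by rewrite def_nu nth_incr_nth.
have lt_i : i < k.
  by rewrite ltnNge; apply/negP => /(fits_nth0 fnu); rewrite nth_nu eqxx.
have lt_mui : nth 0 mu i < k.
  by have := fits_nth pnu fnu i; rewrite nth_nu eqxx.
have nth_t j : nth 0 (tilde_part k mu) j = (a == j) + nth 0 (tilde_part k nu) j.
  have box_mu r := lt_nth_tilde j r pmu.
  have box_nu r : (r < nth 0 (tilde_part k nu) j) =
      (r < k) && (j < k - ((i == k - r.+1) + nth 0 mu (k - r.+1))).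
    by rewrite lt_nth_tilde // nth_nu.
  have lt_box r : (r < nth 0 (tilde_part k mu) j) =
      (r < nth 0 (tilde_part k nu) j) || (a == j) && (r == k - i.+1).
    rewrite box_mu box_nu; have [lt_r|] := ltnP r k; last by rewrite /a; lia.
    have [eq_i|/eqP ne_i] := (i =P k - r.+1); last by rewrite /a; lia.
    by rewrite -eq_i /a; lia.
  have nbox : (a == j) && (k - i.+1 < nth 0 (tilde_part k nu) j) = false.
    rewrite box_nu (_ : k - (k - i.+1).+1 = i); last lia.
    by rewrite eqxx /a; lia.
  case: (a =P j) lt_box nbox => _ /= lt_box nbox; last first.
    by apply: eq_from_lt => r; rewrite lt_box orbF.
  have := lt_box (k - i.+1); rewrite eqxx orbT => lt1.
  have := lt_box (nth 0 (tilde_part k nu) j).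
  have := lt_box (nth 0 (tilde_part k mu) j).-1.
  by move: nbox lt1; rewrite !ltnn; lia.
apply/coversP; split; first exact: tilde_is_part.
exists a; apply: part_eq => [||j]; rewrite ?tilde_is_part ?nth_incr_nth //.
apply: part_incr; first exact: tilde_is_part.
have := part_nth_le (tilde_is_part pmu) (leq_pred a); rewrite !nth_t eqxx.
by case: (a) => //= b; rewrite gtn_eqF.
Qed.

Lemma path_fits la c : is_part la -> path add_box la c -> fits_square k (last la c) ->
  all (fun mu => is_part mu && fits_square k mu) (la :: c).
Proof.
elim: c la => [|nu c IHc] la pla; first by move=> /= _ ->; rewrite pla.
case/andP=> la_nu p_c fit_c; have /coversP[pnu [i def_nu]] := la_nu.
have IH := IHc _ pnu p_c fit_c.
apply/andP; split=> //; rewrite pla /=; case/andP: IH => /andP[_ /andP[size_nu head_nu]] _.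
apply/andP; split.
  by apply: leq_trans size_nu; rewrite def_nu size_incr_nth; case: ltnP => // /leqW.
by apply: leq_trans head_nu; rewrite !head_nth def_nu nth_incr_nth leq_addl.
Qed.

(** Applying the tilde along a path and reversing it is injective, since [tildeK] undoes it on
    diagrams that fit. Exchanging the roles gives equality. *)
Lemma dim_tilde_le kappa la : is_part kappa -> is_part la ->
  fits_square k kappa -> fits_square k la ->
  dim_part la (tilde_part k kappa) <= dim_part kappa (tilde_part k la).
Proof.
move=> pka pla fka fla.
have paths mu nu : exists2 s, uniq s &
    forall c, (c \in s) = path add_box mu c && (last mu c == nu).
  exists [seq c <- box_paths (sumn nu - sumn mu) mu | last mu c == nu].
    by rewrite filter_uniq ?uniq_box_paths.
  move=> c; rewrite mem_filter mem_box_paths.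
  apply/and3P/andP => [[-> _ ->]|[p_c last_c]] //; split=> //.
  by rewrite -(eqP last_c) (sumn_path_add_box p_c) addKn.
have [s1 uniq1 mem1] := paths la (tilde_part k kappa).
have [s2 uniq2 mem2] := paths kappa (tilde_part k la).
rewrite (dim_partE uniq1 mem1) (dim_partE uniq2 mem2).
(* A path is stored without its starting diagram: the tilde of the last diagram is [kappa], the new
   start, and the tilde of [la] becomes the new end. *)
pose f c := [seq tilde_part k mu | mu <- rev (belast la c)].
have good1 c : c \in s1 -> all (fun mu => is_part mu && fits_square k mu) (la :: c).
  rewrite mem1 => /andP[p_c /eqP last_c]; apply: path_fits => //.
  by rewrite last_c tilde_fits.
have injf : {in s1 &, injective f}.
  move=> c d s1c s1d; rewrite /f !map_rev => /(can_inj revK) eq_f.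
  have: la :: c = la :: d; last by case.
  have [] : all (fun mu => is_part mu && fits_square k mu) (belast la c) /\
        all (fun mu => is_part mu && fits_square k mu) (belast la d).
    by split; [have := good1 c s1c | have := good1 d s1d]; rewrite lastI all_rcons => /andP[].
  move: s1c s1d; rewrite !mem1 !lastI => /andP[_ /eqP->] /andP[_ /eqP->] okc okd.
  congr rcons; rewrite -[LHS]map_id -[RHS]map_id.
  have tK s : all (fun mu => is_part mu && fits_square k mu) s ->
      map (tilde_part k) (map (tilde_part k) s) = map id s.
    move=> /allP ok_s; rewrite -map_comp; apply/eq_in_map => mu /ok_s/andP[pmu fmu] /=.
    exact: tildeK.
  by rewrite -(tK _ okc) -(tK _ okd) eq_f.
rewrite -(size_map f); apply: uniq_leq_size; first by rewrite map_inj_in_uniq.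
move=> _ /mapP[c s1c ->]; have ok_c := good1 c s1c.
move: s1c; rewrite mem1 mem2 => /andP[p_c /eqP last_c].
rewrite -{1 2}(tildeK pka fka) -last_c path_map last_map rev_path.
apply/andP; split.
  apply: (sub_in_path _ ok_c p_c) => mu nu /andP[pmu _] /andP[_ fnu].
  exact: tilde_add_box.
by case: (c) => //= mu d; rewrite rev_cons last_rcons.
Qed.

Lemma dim_tilde_sym kappa la : is_part kappa -> is_part la ->
  fits_square k kappa -> fits_square k la ->
  dim_part la (tilde_part k kappa) = dim_part kappa (tilde_part k la).
Proof. by move=> *; apply/eqP; rewrite eqn_leq !dim_tilde_le. Qed.

End Tilde.

(** * Beads and Aitken's formula *)

Definition bead (k : nat) (mu : seq nat) (i : nat) : nat := nth 0 mu i + (k - i.+1).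

Lemma bead_lt k mu i j : is_part mu -> i < j -> j < k -> bead k mu j < bead k mu i.
Proof. by move=> pmu lt_ij lt_j; have := part_nth_le pmu (ltnW lt_ij); rewrite /bead; lia. Qed.

Lemma bead_inj k mu i j : is_part mu -> i < k -> j < k ->
  bead k mu i = bead k mu j -> i = j.
Proof.
move=> pmu lt_i lt_j eq_b; case: (ltngtP i j) => // lt_ij.
  by have := bead_lt pmu lt_ij lt_j; rewrite eq_b ltnn.
by have := bead_lt pmu lt_ij lt_i; rewrite eq_b ltnn.
Qed.

(** A common bead would contradict [lt_nth_tilde]; two disjoint duplicate-free lists of [k] beads
    below [2k] then exhaust the interval. *)
Lemma perm_bead_tilde k mu : is_part mu -> fits_square k mu ->
  perm_eq ([seq bead k (tilde_part k mu) i | i <- iota 0 k] ++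
           [seq bead k mu i | i <- iota 0 k]) (iota 0 (k + k)).
Proof.
move=> pmu fmu; have pt := tilde_is_part k pmu; have ft := tilde_fits k pmu.
have uniq_bead nu : is_part nu -> uniq [seq bead k nu i | i <- iota 0 k].
  move=> pnu; rewrite map_inj_in_uniq ?iota_uniq // => i j.
  rewrite !mem_iota /= !add0n; exact: bead_inj.
have sub_bead nu : is_part nu -> fits_square k nu ->
    {subset [seq bead k nu i | i <- iota 0 k] <= iota 0 (k + k)}.
  move=> pnu fnu _ /mapP[i + ->]; rewrite !mem_iota /bead => lt_i.
  by have := fits_nth pnu fnu i; lia.
have uniq_cat : uniq ([seq bead k (tilde_part k mu) i | i <- iota 0 k] ++
                      [seq bead k mu i | i <- iota 0 k]).
  rewrite cat_uniq !uniq_bead // andbT /=; apply/hasPn => _ /mapP[i + ->].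
  rewrite mem_iota /= => lt_i; apply/negP => /mapP[j]; rewrite mem_iota /bead /= => lt_j.
  have := lt_nth_tilde k j (k - i.+1) pmu.
  by rewrite (_ : k - (k - i.+1).+1 = i); lia.
apply: uniq_perm => //; first exact: iota_uniq.
apply: (fun sub le_size => (uniq_min_size uniq_cat sub le_size).2) => [b|].
  by rewrite mem_cat => /orP[]; exact: sub_bead.
by rewrite size_cat !size_map !size_iota.
Qed.

Lemma sumn_nth mu k : size mu <= k -> sumn mu = \sum_(i < k) nth 0 mu i.
Proof.
move=> le_k; rewrite sumnE (big_nth 0) -(big_mkord xpredT (nth 0 mu)).
rewrite (big_cat_nat (leq0n _) le_k) /= [X in _ + X]big_nat_cond [X in _ + X]big1 ?addn0 //.
by move=> i /andP[/andP[le_i _] _]; rewrite nth_default.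
Qed.

(** Summing the beads: the two staircases remove [k (k - 1)] from [k (2k - 1)]. *)
Lemma sumn_tilde k mu : is_part mu -> fits_square k mu ->
  sumn (tilde_part k mu) + sumn mu = k ^ 2.
Proof.
move=> pmu fmu; have := perm_sumn (perm_bead_tilde pmu fmu).
have sum_bead nu : fits_square k nu ->
    sumn [seq bead k nu i | i <- iota 0 k] = sumn nu + sumn (iota 0 k).
  case/andP=> le_k _; rewrite (sumn_nth le_k) !sumnE big_map big_split /=.
  rewrite -[X in iota 0 X]subn0 -/(index_iota 0 k) big_mkord; congr (_ + _).
  by rewrite [LHS]big_nat_rev /= big_nat [RHS]big_nat; apply: eq_bigr => i /=; lia.
have sum_iota n : 2 * sumn (iota 0 n) = n * n.-1.
  elim: n => // n IHn; rewrite -[in iota 0 _]addn1 iotaD sumn_cat mulnDr IHn /=; case: (n) => /=; lia.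
rewrite sumn_cat !sum_bead ?tilde_fits //.
by have := sum_iota k; have := sum_iota (k + k); rewrite -mulnn; case: k {pmu fmu sum_bead} => /=; nia.
Qed.

Local Open Scope ring_scope.

(** Aitken's matrix of the [1 / (mu_i - i - la_j + j)!], with row [i] multiplied by [(bead k mu i)!]
    to make the entries falling factorials. *)
Definition bead_mx (R : pzRingType) (k : nat) (mu la : seq nat) : 'M[R]_k :=
  \matrix_(i, j) (bead k mu i ^_ bead k la j)%:R.

(** In the term of a permutation [s], the weights add up to [\sum_i (x i - y (s i))], which does not
    depend on [s]. *)
Lemma det_col_weight_sum (R : comNzRingType) k (A : 'M[R]_k) (x y : 'I_k -> R) :
  \sum_j \det (\matrix_(i, j') (A i j' * (if j' == j then x i - y j else 1))) =
  (\sum_i x i - \sum_j y j) * \det A.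
Proof.
rewrite /determinant exchange_big mulr_sumr; apply: eq_bigr => s _ /=.
rewrite -mulr_sumr mulrCA; congr (_ * _).
rewrite (reindex s) /=; last by exists (s^-1)%g => i _; rewrite ?permK ?permKV.
rewrite [X in _ = (_ - X) * _](reindex s) /=; last by exists (s^-1)%g => i _; rewrite ?permK ?permKV.
rewrite -sumrB mulr_suml; apply: eq_bigr => i _.
under eq_bigr => i' _ do rewrite mxE (inj_eq perm_inj).
rewrite big_split /= mulrC; congr (_ * _).
by rewrite -big_mkcond big_pred1_eq.
Qed.

Lemma det_bead_diag k la : is_part la ->
  \det (bead_mx rat k la la) = \prod_(i < k) ((bead k la i)`!)%:R.
Proof.
move=> pla; rewrite -det_tr det_trig.
  by apply: eq_bigr => i _; rewrite !mxE ffactnn.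
apply/is_trig_mxP => i j lt_ij; rewrite !mxE ffact_small //.
exact: bead_lt.
Qed.

(** In a nonzero term of the expansion each bead of [mu] is at least the bead of [la] matched with
    it. Equal sums force equality throughout, so the decreasing bead sequences agree. *)
Lemma det_bead_neq k mu la : is_part mu -> is_part la ->
  (size mu <= k)%N -> (size la <= k)%N -> sumn mu = sumn la -> mu != la ->
  \det (bead_mx rat k mu la) = 0.
Proof.
move=> pmu pla size_mu size_la eq_sum /eqP ne; apply: big1 => s _.
suff [i lt_i] : exists i : 'I_k, (bead k mu i < bead k la (s i))%N.
  by rewrite (bigD1 i) //= mxE ffact_small // mul0r mulr0.
apply/existsP; apply: contra_notT ne => /existsPn le_bead.
have sum_bead nu : (size nu <= k)%N ->
    (\sum_(i < k) bead k nu i = sumn nu + \sum_(i < k) (k - i.+1))%N.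
  by move=> size_nu; rewrite (sumn_nth size_nu) -big_split.
have eq_bead (i : 'I_k) : bead k mu i = bead k la (s i).
  have /leqif_sum : forall j : 'I_k, true ->
      (bead k la (s j) <= bead k mu j ?= iff (bead k la (s j) == bead k mu j))%N.
    by move=> j _; apply/leqifP; case: eqP => // /eqP; rewrite ltn_neqAle leqNgt le_bead => ->.
  have <- : \sum_(j < k) bead k la j = \sum_(j < k) bead k la (s j).
    by rewrite (reindex s) //; exists (s^-1)%g => j _; rewrite ?permK ?permKV.
  rewrite !sum_bead // eq_sum => -[_]; rewrite eqxx => /esym/forallP/(_ i)/eqP; exact: esym.
have seqs : [seq bead k mu i | i <- iota 0 k] = [seq bead k la i | i <- iota 0 k].
  have sorted_bead nu : is_part nu -> sorted (fun a b => b < a)%N [seq bead k nu i | i <- iota 0 k].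
    move=> pnu; apply/(sortedP 0%N) => i; rewrite size_map size_iota => lt_i.
    rewrite !(nth_map 0%N) ?size_iota ?nth_iota ?(ltnW lt_i) // !add0n.
    exact: bead_lt.
  apply: (@irr_sorted_eq _ (fun a b => b < a)%N); rewrite ?sorted_bead //.
  - by move=> b a c /= lt_ba lt_cb; exact: ltn_trans lt_ba.
  - by move=> a; exact: ltnn.
  move=> b; apply/mapP/mapP => -[i]; rewrite mem_iota => /= lt_i ->.
    by exists (s (Ordinal lt_i)); rewrite ?mem_iota //= (eq_bead (Ordinal lt_i)).
  exists (s^-1%g (Ordinal lt_i)); rewrite ?mem_iota //=.
  by rewrite eq_bead permKV.
apply: part_eq => // i; have [lt_i|le_i] := ltnP i k; last first.
  by rewrite !nth_default // (leq_trans _ le_i).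
have := congr1 (fun t => nth 0%N t i) seqs.
by rewrite /= !(nth_map 0%N) ?size_iota ?nth_iota // !add0n /bead => /addIn.
Qed.

Lemma bead_incr k la j i : (i < k)%N -> bead k (incr_nth la j) i = ((j == i) + bead k la i)%N.
Proof. by move=> lt_i; rewrite /bead nth_incr_nth addnA. Qed.

(** This is [n ^_ m.+1 = n ^_ m * (n - m)]; the difference may be taken in the rationals because
    [n ^_ m] vanishes when [n < m]. *)
Lemma det_bead_incr k mu la (j : 'I_k) :
  \det (bead_mx rat k mu (incr_nth la j)) =
  \det (\matrix_(i, j') (bead_mx rat k mu la i j' *
     (if j' == j then (bead k mu i)%:R - (bead k la j)%:R else 1))).
Proof.
congr (\det _); apply/matrixP => i j'; rewrite !mxE bead_incr // eq_sym -val_eqE /=.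
case: eqP => [/val_inj->|_]; rewrite ?mulr1 //= add1n ffactnSr natrM.
have [le_b|lt_b] := leqP (bead k la j) (bead k mu i); first by rewrite natrB.
by rewrite ffact_small // !mul0r.
Qed.

(** The box is refused because the row above has the same length; raising the bead then makes two
    neighbouring columns coincide. *)
Lemma det_bead_incr_eq0 k mu la (j : 'I_k) : is_part la -> ~~ is_part (incr_nth la j) ->
  \det (bead_mx rat k mu (incr_nth la j)) = 0.
Proof.
move=> pla; case: j => -[|j] lt_j npart; first by rewrite part_incr in npart.
have eq_la : nth 0%N la j.+1 = nth 0%N la j.
  apply/eqP; rewrite eqn_leq part_nth_le //= leqNgt; apply: contra npart => lt_la.
  by rewrite part_incr.
rewrite -det_tr (determinant_alternate (i1 := Ordinal (ltnW lt_j)) (i2 := Ordinal lt_j)) //.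
  by rewrite -val_eqE /= ltn_eqF.
move=> i; rewrite !mxE /=; congr (_ ^_ _)%:R.
by rewrite !bead_incr ?(ltnW lt_j) // eqxx gtn_eqF // /bead eq_la; lia.
Qed.

(* Aitken's determinantal formula for the number of standard skew tableaux. *)
Lemma dim_part_det k mu la m : is_part mu -> is_part la ->
  (size mu <= k)%N -> (size la <= k)%N -> sumn mu = (sumn la + m)%N ->
  (dim_part la mu)%:R * \prod_(i < k) ((bead k mu i)`!)%:R =
  (m`!)%:R * \det (bead_mx rat k mu la).
Proof.
move=> pmu + size_mu; elim: m la => [|m IHm] la pla size_la eq_sum.
  rewrite dim_part_eq_sumn ?eq_sum ?addn0 // mul1r eq_sym.
  have [<-|ne] := eqVneq; first by rewrite mul1r det_bead_diag.
  by rewrite mul0r det_bead_neq // eq_sum addn0.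
rewrite dim_part_rec; last by lia.
rewrite (@big_covers _ _ _ _ k.+1) //= big_mkcond big_ord_recr /= -big_mkcond /=.
rewrite [X in (_ + X)%N](_ : _ = 0%N) ?addn0; last first.
  case: ifP => // _; apply: dim_part_size.
  by rewrite size_incr_nth [(k < _)%N]ltnNge size_la.
rewrite natr_sum mulr_suml.
transitivity (\sum_(j < k) (m`!)%:R * \det (bead_mx rat k mu (incr_nth la j))).
  rewrite big_mkcond; apply: eq_bigr => j _; case: ifPn => [pj|npj]; last first.
    by rewrite det_bead_incr_eq0 // mulr0.
  rewrite IHm ?sumn_incr_nth // ?eq_sum ?addSnnS //.
  by rewrite size_incr_nth; case: ifP.
rewrite -mulr_sumr; under eq_bigr do rewrite det_bead_incr.
rewrite det_col_weight_sum factS mulnC natrM -mulrA; congr (_ * (_ * _)).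
(* The staircases cancel, so the total weight is [|mu| - |la| = m + 1]. *)
rewrite -!natr_sum /bead !big_split /= -!(sumn_nth size_mu) -(sumn_nth size_la) eq_sum.
by rewrite !natrD; ring.
Qed.

(** * Reduction modulo the polynomial of the beads *)

(* When [Q] is monic of degree [k], this is the coefficient of [1 / X] in the
   expansion of [f / Q] at infinity. *)
Definition res_inf (F : fieldType) (Q : {poly F}) (k : nat) (f : {poly F}) : F :=
  (f %% Q)`_k.-1.

Section Residue.

Variables (F : fieldType) (Q : {poly F}) (k : nat).

Lemma res_inf_sum (I : Type) (s : seq I) (P : pred I) (c : I -> F) (f : I -> {poly F}) :
  res_inf Q k (\sum_(i <- s | P i) c i *: f i) = \sum_(i <- s | P i) c i * res_inf Q k (f i).
Proof.
rewrite /res_inf (big_morph (fun p => p %% Q) (id1 := 0) (op1 := +%R)) ?mod0p //; last first.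
  by move=> p q; rewrite modpD.
by rewrite coef_sum; apply: eq_bigr => i _; rewrite modpZl coefZ.
Qed.

Hypothesis size_Q : size Q = k.+1.

Lemma res_inf_small (f : {poly F}) : (size f < k)%N -> res_inf Q k f = 0.
Proof.
move=> lt_f; rewrite /res_inf modp_small ?size_Q ?(ltn_trans lt_f) //.
by rewrite nth_default // -ltnS prednK // (leq_trans _ lt_f).
Qed.

Lemma res_inf_monic (f : {poly F}) : f \is monic -> size f = k -> res_inf Q k f = 1.
Proof. by move=> /monicP lead_f size_f; rewrite /res_inf modp_small ?size_Q ?size_f // -size_f. Qed.

Lemma res_inf_mod a f : res_inf Q k ('X^a * f) = res_inf Q k ('X^a * (f %% Q)).
Proof. by rewrite /res_inf modp_mul. Qed.

(* Through the Vandermonde and Hankel matrices of [Q], both determinants become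
   multiples of that of the coefficients of the [f j] modulo [Q]. *)
Lemma det_eval_ratio (x : 'I_k -> F) (f g : 'I_k -> {poly F}) :
  (forall i, root Q (x i)) ->
  (forall j : 'I_k, g j \is monic) -> (forall j : 'I_k, size (g j) = (k - j)%N) ->
  \det (\matrix_(i, j) (f j).[x i]) =
  \det (\matrix_(i, j) (g j).[x i]) * \det (\matrix_(a < k, j < k) res_inf Q k ('X^a * f j)).
Proof.
move=> root_x monic_g size_g.
pose V : 'M[F]_k := \matrix_(i, r) x i ^+ r.
pose H : 'M[F]_k := \matrix_(a, r) res_inf Q k 'X^(a + r).
pose C (h : 'I_k -> {poly F}) : 'M[F]_k := \matrix_(r, j) (h j %% Q)`_r.
have size_mod (h : {poly F}) : (size (h %% Q)%R <= k)%N.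
  by rewrite -ltnS -size_Q ltn_modp -size_poly_gt0 size_Q.
have VC h : \matrix_(i, j) (h j).[x i] = V *m C h.
  apply/matrixP => i j; rewrite !mxE {1}(divp_eq (h j) Q) hornerD hornerM.
  rewrite (rootP (root_x i)) mulr0 add0r (horner_coef_wide _ (size_mod _)).
  by apply: eq_bigr => r _; rewrite !mxE mulrC.
have HC h : \matrix_(a < k, j < k) res_inf Q k ('X^a * h j) = H *m C h.
  apply/matrixP => a j; rewrite !mxE res_inf_mod.
  have -> : 'X^a * (h j %% Q) = \sum_(r < k) (h j %% Q)`_r *: 'X^(a + r).
    have {1}-> : h j %% Q = \sum_(r < k) (h j %% Q)`_r *: 'X^r.
      rewrite -poly_def; apply/polyP => r; rewrite coef_poly; case: ltnP => //.
      by move=> /(leq_trans (size_mod _)) le_r; rewrite nth_default.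
    by rewrite mulr_sumr; apply: eq_bigr => r _; rewrite -scalerAr -exprD.
  by rewrite res_inf_sum; apply: eq_bigr => r _; rewrite !mxE mulrC.
(* The degrees [k - 1 - j] make this matrix unitriangular, so [\det H * \det (C g) = 1] and [H]
   drops out of the ratio. *)
have : \det (\matrix_(a < k, j < k) res_inf Q k ('X^a * g j)) = 1.
  have size_Xg (a j : 'I_k) : size ('X^a * g j) = (a + (k - j))%N.
    by rewrite mulrC size_mulXn ?size_g ?monic_neq0.
  rewrite det_trig; first (apply: big1 => j _; rewrite mxE res_inf_monic //).
  - by rewrite monicMl ?monicXn.
  - by rewrite size_Xg subnKC // ltnW.
  apply/is_trig_mxP => a j lt_aj; rewrite mxE res_inf_small //.
  by rewrite size_Xg; have := ltn_ord j; lia.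
rewrite !VC !HC !det_mulmx => HCg.
by rewrite -[LHS]mulr1 -HCg; ring.
Qed.

End Residue.

(** The matrix is block lower triangular with a unitriangular last block. This brings determinants
    of growing size [k] down to a fixed size. *)
Lemma det_ulblock (R : comNzRingType) (k l : nat) (M : nat -> nat -> R) : (l <= k)%N ->
  (forall i j, (l <= j < k)%N -> (i < j)%N -> M i j = 0) ->
  (forall j, (l <= j < k)%N -> M j j = 1) ->
  \det (\matrix_(i < k, j < k) M i j) = \det (\matrix_(i < l, j < l) M i j).
Proof.
move=> le_lk; rewrite -(subnKC le_lk); move: (k - l)%N => n M0 M1.
set A : 'M[R]_(l + n) := (X in \det X = _).
have ur0 : ursubmx A = 0.
  apply/matrixP => i j; rewrite !mxE M0 //= ?ltn_add2l ?leq_addr ?ltn_ord //.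
  exact: leq_trans (ltn_ord i) (leq_addr _ _).
rewrite -(submxK A) ur0 det_lblock [X in _ * X]det_trig.
  rewrite [X in _ * X]big1 => [|i _]; last by rewrite !mxE M1 //= ltn_add2l leq_addr /=.
  by rewrite mulr1; congr (\det _); apply/matrixP => i j; rewrite !mxE.
by apply/is_trig_mxP => i j lt_ij; rewrite !mxE M0 //= ?ltn_add2l ?leq_addr ?ltn_ord.
Qed.

(** * Polynomial dependence on the side of the square *)

Definition root_poly (s : seq nat) : {poly rat} := \prod_(b <- s) ('X - (b%:R)%:P).

(** The reciprocal polynomial of [root_poly s]: the latter divided by [X^(size s)] and written in
    [1 / X]. *)
Definition rev_root_poly (s : seq nat) : {poly rat} := \prod_(b <- s) (1 - b%:R *: 'X).

Lemma root_poly_monic s : root_poly s \is monic.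
Proof. exact: monic_prod_XsubC. Qed.

Lemma size_root_poly s : size (root_poly s) = (size s).+1.
Proof. exact: size_prod_XsubC. Qed.

Lemma rev_root_poly_cons b s :
  rev_root_poly (b :: s) = rev_root_poly s - b%:R *: ('X * rev_root_poly s).
Proof. by rewrite /rev_root_poly big_cons mulrBl mul1r scalerAl. Qed.

Lemma rev_root_poly_perm s t : perm_eq s t -> rev_root_poly s = rev_root_poly t.
Proof. exact: perm_big. Qed.

Lemma rev_root_poly_cat s t : rev_root_poly (s ++ t) = rev_root_poly s * rev_root_poly t.
Proof. exact: big_cat. Qed.

Lemma size_rev_root_poly s : (size (rev_root_poly s) <= (size s).+1)%N.
Proof.
elim: s => [|b s IHs]; first by rewrite /rev_root_poly big_nil size_poly1.
rewrite rev_root_poly_cons (leq_trans (size_polyD _ _)) // geq_max (leq_trans IHs) //= size_polyN.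
rewrite (leq_trans (size_scale_leq _ _)) // mulrC.
by rewrite (leq_trans (size_polyMleq _ _)) // size_polyX addn2.
Qed.

Lemma rev_root_poly0 s : (rev_root_poly s)`_0 = 1.
Proof.
elim: s => [|b s IHs]; first by rewrite /rev_root_poly big_nil coef1.
by rewrite rev_root_poly_cons coefB coefZ coefXM mulr0 subr0.
Qed.

Lemma coef_root_poly s i : (i <= size s)%N ->
  (root_poly s)`_i = (rev_root_poly s)`_(size s - i).
Proof.
elim: s i => [|b s IHs] i.
  by rewrite leqn0 => /eqP->; rewrite /root_poly /rev_root_poly !big_nil.
rewrite rev_root_poly_cons /root_poly big_cons -/(root_poly s) mulrBl /= => le_i.
rewrite !coefB coefXM coefCM coefZ coefXM; case: i le_i => [_|i le_i] /=.
  rewrite subn0 IHs // subn0 /= [(rev_root_poly s)`_(size s).+1]nth_default //.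
  exact: size_rev_root_poly.
rewrite subSS IHs //; congr (_ - _ * _); rewrite subn_eq0.
have [le_si|lt_is] := leqP (size s) i; last by rewrite IHs // subnS.
by rewrite nth_default // size_root_poly.
Qed.

Lemma sum_ord_widen (V : nmodType) m n (F : nat -> V) : (m <= n)%N ->
  (forall j, (m <= j)%N -> F j = 0) -> \sum_(j < m) F j = \sum_(j < n) F j.
Proof.
move=> le_mn F0; rewrite -!(big_mkord xpredT F) [RHS](big_cat_nat (leq0n _) le_mn) /=.
rewrite [X in _ + X]big_nat_cond [X in _ + X]big1 ?addr0 // => i.
by move=> /andP[/andP[/F0]].
Qed.

Section ResidueRoots.

Variables (Q W : {poly rat}) (k n : nat).
Hypotheses (size_Q : size Q = k.+1) (k_gt0 : (0 < k)%N).
Hypothesis W_coef : forall i, (i <= n)%N -> W`_i = res_inf Q k 'X^(k.-1 + i).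

(** For monic [Q], [W] is to order [n] the expansion of [X^k / Q] in powers of [1 / X]. As
    [X^a * root_poly s] is [X^(k + n - 1)] times the reversed polynomial at [1 / X], the residue is
    a convolution. *)
Lemma res_inf_root_poly a s : (a + size s).+1 = (k + n)%N ->
  res_inf Q k ('X^a * root_poly s) = (rev_root_poly s * W)`_n.
Proof.
move=> eq_n; set d := size s.
have -> : 'X^a * root_poly s = \sum_(i < d.+1) (root_poly s)`_i *: 'X^(a + i).
  have {1}-> : root_poly s = \sum_(i < d.+1) (root_poly s)`_i *: 'X^i.
    by rewrite -poly_def /d -size_root_poly coefK.
  by rewrite mulr_sumr; apply: eq_bigr => r _; rewrite -scalerAr -exprD.
pose F j := (rev_root_poly s)`_j * res_inf Q k 'X^(a + d - j).
rewrite res_inf_sum coefM.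
transitivity (\sum_(j < d.+1) F j).
  rewrite (reindex_inj rev_ord_inj); apply: eq_bigr => j _ /=.
  have lt_j := ltn_ord j.
  rewrite subSS coef_root_poly ?leq_subr // subKn // /F addnBA //.
transitivity (\sum_(j < n.+1) F j); last first.
  apply: eq_bigr => j _; have lt_j := ltn_ord j; rewrite /F W_coef ?leq_subr //.
  by congr (_ * res_inf _ _ 'X^_); lia.
rewrite (sum_ord_widen (n := d.+1 + n.+1)) ?leq_addr //; last first.
  move=> j lt_j; rewrite /F nth_default ?mul0r //.
  exact: leq_trans (size_rev_root_poly s) lt_j.
symmetry; apply: sum_ord_widen => [|j lt_j]; first exact: leq_addl.
have [lt_d|le_d] := ltnP d j.
  by rewrite /F nth_default ?mul0r // (leq_trans (size_rev_root_poly s)).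
by rewrite /F res_inf_small ?mulr0 // size_polyXn; lia.
Qed.

End ResidueRoots.

(** For positive [n] this coefficient is the residue of a multiple of [root_poly s]. Thus [W]
    inverts [rev_root_poly s] as a power series, to the order where its coefficients are known. *)
Lemma rev_root_poly_inv s (W : {poly rat}) k n :
  size s = k -> (0 < k)%N ->
  (forall i, (i <= n)%N -> W`_i = res_inf (root_poly s) k 'X^(k.-1 + i)) ->
  (rev_root_poly s * W)`_n = (n == 0)%:R.
Proof.
move=> size_s k_gt0 W_coef; have size_Q : size (root_poly s) = k.+1 by rewrite size_root_poly size_s.
case: n W_coef => [|n] W_coef.
  rewrite coefM big_ord1 rev_root_poly0 mul1r W_coef // addn0.
  by rewrite res_inf_monic ?monicXn // size_polyXn prednK.
rewrite -(res_inf_root_poly size_Q k_gt0 W_coef (a := n)); last by rewrite size_s; lia.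
by rewrite /res_inf modp_mull coef0.
Qed.

(** * Functions of the side that are polynomial from a threshold on *)

Definition poly_on (K n : nat) (f : nat -> rat) :=
  exists2 p : {poly rat}, (size p <= n.+1)%N & forall k, (K <= k)%N -> f k = p.[k%:R].

Section PolyOn.

Variable K : nat.

Lemma poly_on_ext n f g : (forall k, (K <= k)%N -> f k = g k) -> poly_on K n f -> poly_on K n g.
Proof. by move=> eq_fg [p size_p fE]; exists p => // k le_k; rewrite -eq_fg ?fE. Qed.

Lemma poly_on_const c : poly_on K 0 (fun=> c).
Proof. by exists c%:P => [|k _]; rewrite ?size_polyC_leq1 ?hornerC. Qed.

Lemma poly_on0 n : poly_on K n (fun=> 0).
Proof. by exists 0 => [|k _]; rewrite ?size_poly0 ?horner0. Qed.

Lemma poly_onD n f g : poly_on K n f -> poly_on K n g -> poly_on K n (fun k => f k + g k).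
Proof.
move=> [p sp fE] [q sq gE]; exists (p + q) => [|k le_k]; last by rewrite hornerD fE ?gE.
by rewrite (leq_trans (size_polyD _ _)) // geq_max sp.
Qed.

Lemma poly_onM m n f g : poly_on K m f -> poly_on K n g -> poly_on K (m + n) (fun k => f k * g k).
Proof.
move=> [p sp fE] [q sq gE]; exists (p * q) => [|k le_k]; last by rewrite hornerM fE ?gE.
by rewrite (leq_trans (size_polyMleq _ _)) // -ltnS; lia.
Qed.

Lemma poly_onZ n c f : poly_on K n f -> poly_on K n (fun k => c * f k).
Proof. by move=> fP; rewrite -[n]add0n; apply: poly_onM fP; apply: poly_on_const. Qed.

Lemma poly_onB n f g : poly_on K n f -> poly_on K n g -> poly_on K n (fun k => f k - g k).
Proof.
move=> fP gP; apply: poly_on_ext (poly_onD fP (poly_onZ (-1) gP)) => k _.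
by rewrite mulN1r.
Qed.

Lemma poly_on_sum n (I : finType) (f : I -> nat -> rat) :
  (forall i, poly_on K n (f i)) -> poly_on K n (fun k => \sum_i f i k).
Proof.
move=> fP; have /fin_all_exists[p /all_and2[sp fE]] : forall i, exists p : {poly rat},
    (size p <= n.+1)%N /\ forall k, (K <= k)%N -> f i k = p.[k%:R].
  by move=> i; have [p sp fE] := fP i; exists p.
exists (\sum_i p i) => [|k le_k]; first by apply: leq_trans (size_sum _ _ _) _; apply/bigmax_leqP.
by rewrite horner_sum; apply: eq_bigr => i _; apply: fE.
Qed.

Lemma poly_on_prod (I : finType) (n : I -> nat) (f : I -> nat -> rat) :
  (forall i, poly_on K (n i) (f i)) ->
  poly_on K (\sum_i n i) (fun k => \prod_i f i k).
Proof.
move=> fP; elim: (index_enum I) => [|i s IHs].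
  by rewrite big_nil; apply: poly_on_ext (poly_on_const 1) => k _; rewrite big_nil.
rewrite big_cons; apply: poly_on_ext (poly_onM (fP i) IHs) => k _.
by rewrite big_cons.
Qed.

Lemma poly_on_comp K' n f (h : nat -> nat) (a b : rat) :
  poly_on K n f -> (forall k, (K' <= k)%N -> (K <= h k)%N /\ (h k)%:R = a * k%:R + b) ->
  poly_on K' n (fun k => f (h k)).
Proof.
move=> [p sp fE] hP; exists (p \Po (a *: 'X + b%:P)) => [|k /hP[le_h eq_h]]; last first.
  by rewrite horner_comp fE // eq_h !hornerE.
have sq : (size (a *: 'X + b%:P)%R <= 2)%N.
  rewrite (leq_trans (size_polyD _ _)) // geq_max (leq_trans (size_scale_leq _ _)) ?size_polyX //.
  exact: leq_trans (size_polyC_leq1 _) _.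
by rewrite (leq_trans (size_comp_poly_leq _ _)) //; move: (size _) (size _) sp sq; nia.
Qed.

End PolyOn.

Lemma horner_root_poly_iota n (k : nat) : (root_poly (iota 0 n)).[k%:R] = (k ^_ n)%:R.
Proof.
elim: n => [|n IHn]; first by rewrite /root_poly big_nil hornerC.
rewrite -[in iota 0 _]addn1 iotaD /root_poly big_cat big_seq1 hornerM IHn hornerXsubC.
rewrite ffactnSr natrM; have [le_n|lt_k] := leqP n k; first by rewrite natrB.
by rewrite ffact_small // !mul0r.
Qed.

(** Discrete integration: the difference of [x ^_ n.+1] is [n.+1 * x ^_ n], so removing the leading
    term in the falling factorial basis lowers the degree. *)
Lemma poly_on_antidiff n (f : nat -> rat) :
  poly_on 0 n (fun k => f k.+1 - f k) -> poly_on 0 n.+1 f.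
Proof.
move=> [p sp fE].
suff [q sq qE] : exists2 q : {poly rat}, (size q <= n.+2)%N &
    forall k : nat, q.[k.+1%:R] - q.[k%:R] = p.[k%:R].
  exists (q + (f 0%N - q.[0])%:P) => [|k _].
    by rewrite (leq_trans (size_polyD _ _)) // geq_max sq (leq_trans (size_polyC_leq1 _)).
  rewrite hornerD hornerC; elim: k => [|k IHk]; first by ring.
  by rewrite -[f k.+1](subrK (f k)) fE // IHk -qE; ring.
move: n.+1 sp => {}n; elim: n p {fE} => [|n IHn] p sp.
  exists 0 => [|k]; first by rewrite size_poly0.
  by move: sp; rewrite leqn0 size_poly_eq0 => /eqP->; rewrite !horner0 subr0.
have size_ff m : size (root_poly (iota 0 m)) = m.+1 by rewrite size_root_poly size_iota.
have [|q sq qE] := IHn (p - p`_n *: root_poly (iota 0 n)).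
  apply/leq_sizeP => j; rewrite leq_eqVlt => /predU1P[<-|lt_j]; rewrite coefB coefZ.
    have /monicP := root_poly_monic (iota 0 n); rewrite /lead_coef size_ff /= => ->.
    by rewrite mulr1 subrr.
  by rewrite ![_`_j]nth_default ?mulr0 ?subrr ?size_ff // (leq_trans sp).
exists (q + (p`_n / n.+1%:R) *: root_poly (iota 0 n.+1)) => [|k].
  rewrite (leq_trans (size_polyD _ _)) // geq_max (leq_trans sq) //.
  by rewrite (leq_trans (size_scale_leq _ _)) // size_ff.
rewrite !hornerD !hornerZ !horner_root_poly_iota.
have := qE k; rewrite hornerD hornerN hornerZ horner_root_poly_iota => /(canRL (subrK _)) ->.
rewrite ffactSS ffactnSr !natrM.
have -> : (k ^_ n)%:R * (k - n)%:R = (k ^_ n)%:R * (k%:R - n%:R) :> rat.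
  have [le_n|lt_k] := leqP n k; first by rewrite natrB.
  by rewrite ffact_small // !mul0r.
by field; rewrite nat1r pnatr_eq0.
Qed.

(** Degree [2 s] for the coefficient of [X^s] is a grading compatible with products, and it is the
    growth of the elementary symmetric functions of [0, ..., k - 1]. *)
Definition coef_poly_on K (P : nat -> {poly rat}) :=
  forall s, poly_on K (2 * s) (fun k => (P k)`_s).

Lemma coef_poly_on1 K : coef_poly_on K (fun=> 1).
Proof.
case=> [|s]; last by apply: poly_on_ext (poly_on0 _ _) => k _; rewrite coef1.
by apply: poly_on_ext (poly_on_const _ 1) => k _; rewrite coef1.
Qed.

Lemma coef_poly_onM K P R : coef_poly_on K P -> coef_poly_on K R ->
  coef_poly_on K (fun k => P k * R k).
Proof.
move=> PP RP s; have: poly_on K (2 * s) (fun k => \sum_(j < s.+1) (P k)`_j * (R k)`_(s - j)).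
  apply: poly_on_sum => j; rewrite (_ : 2 * s = 2 * j + 2 * (s - j))%N; first exact: poly_onM.
  by have := ltn_ord j; lia.
by apply: poly_on_ext => k _; rewrite coefM.
Qed.

Lemma coef_poly_on_prod K (I : Type) (r : seq I) (P : I -> nat -> {poly rat}) :
  (forall i, coef_poly_on K (P i)) -> coef_poly_on K (fun k => \prod_(i <- r) P i k).
Proof.
move=> PP; elim: r => [|i r IHr] s.
  by apply: poly_on_ext (coef_poly_on1 K s) => k _; rewrite big_nil.
by apply: poly_on_ext (coef_poly_onM (PP i) IHr s) => k _; rewrite big_cons.
Qed.

Lemma coef_poly_on_linear K (h : nat -> nat) (a b : rat) :
  (forall k, (K <= k)%N -> (h k)%:R = a * k%:R + b) ->
  coef_poly_on K (fun k => 1 - (h k)%:R *: 'X).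
Proof.
move=> hP [|[|s]]; last first.
- by apply: poly_on_ext (poly_on0 _ _) => k _; rewrite coefB coefZ coefX coef1 mulr0 subr0.
- exists (- (a *: 'X + b%:P)) => [|k le_k]; last first.
    by rewrite coefB coefZ coefX coef1 mulr1 sub0r hP // !hornerE.
  rewrite size_polyN (leq_trans (size_polyD _ _)) // geq_max.
  rewrite (leq_trans (size_scale_leq _ _)) ?size_polyX //.
  exact: leq_trans (size_polyC_leq1 _) _.
by apply: poly_on_ext (poly_on_const _ 1) => k _; rewrite coefB coefZ coefX coef1 mulr0 subr0.
Qed.

(** Going from [k] to [k.+1] multiplies by [1 - k X], so the coefficient of [X^(s + 1)] changes by
    [- k] times that of [X^s], of degree at most [2 s + 1]; summation adds one degree. *)
Lemma coef_poly_on_iota : coef_poly_on 0 (fun k => rev_root_poly (iota 0 k)).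
Proof.
elim=> [|s IHs].
  by apply: poly_on_ext (poly_on_const _ 1) => k _; rewrite rev_root_poly0.
have idP : poly_on 0 1 (fun k => k%:R).
  by exists 'X => [|k _]; rewrite ?size_polyX ?hornerX.
rewrite mulnS; apply: poly_on_antidiff.
apply: poly_on_ext (poly_onZ (-1) (poly_onM idP IHs)) => k _.
rewrite -[k.+1 in RHS]addn1 iotaD rev_root_poly_cat.
rewrite [rev_root_poly (iota (0 + k) 1)](_ : _ = 1 - k%:R *: 'X); last exact: big_seq1.
rewrite mulrBr mulr1 -scalerAr coefB coefZ coefMX /=.
by ring.
Qed.

Lemma coef_poly_on_iota_comp K (h : nat -> nat) (a b : rat) :
  (forall k, (K <= k)%N -> (h k)%:R = a * k%:R + b) ->
  coef_poly_on K (fun k => rev_root_poly (iota 0 (h k))).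
Proof. by move=> hP s; apply: (poly_on_comp (coef_poly_on_iota s)) => k le_k; split; last exact: hP. Qed.

(** Power series division: as [T] has constant term 1, the relation at order [s] expresses [w k s]
    by a coefficient of [M] and earlier values of [w], and the grading bounds each product by
    [2 s]. *)
Lemma poly_on_quotient K (T M : nat -> {poly rat}) (w : nat -> nat -> rat) :
  coef_poly_on K T -> coef_poly_on K M -> (forall k, (T k)`_0 = 1) ->
  (forall k s, (K <= k)%N -> \sum_(j < s.+1) (T k)`_j * w k (s - j)%N = (M k)`_s) ->
  forall s, poly_on K (2 * s) (w^~ s).
Proof.
move=> TP MP T0 wE; elim/ltn_ind => s IHs.
have: poly_on K (2 * s) (fun k => (M k)`_s - \sum_(j < s) (T k)`_j.+1 * w k (s - j.+1)%N).
  apply: poly_onB => //; apply: poly_on_sum => j; have lt_j := ltn_ord j.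
  rewrite (_ : 2 * s = 2 * j.+1 + 2 * (s - j.+1))%N; last by lia.
  by apply: poly_onM => //; apply: IHs; lia.
apply: poly_on_ext => k le_k; rewrite -wE // big_ord_recl T0 mul1r subn0 /=.
by rewrite addrK.
Qed.

(** * The shifted Schur determinant *)

Definition bead_seq (k : nat) (mu : seq nat) : seq nat := [seq bead k mu i | i <- iota 0 k].

Lemma size_bead_seq k mu : size (bead_seq k mu) = k.
Proof. by rewrite size_map size_iota. Qed.

(** The zero rows contribute the beads [0, ..., k - size mu - 1], leaving a number of beads
    independent of [k]. *)
Lemma perm_bead_seq k mu : (size mu <= k)%N ->
  perm_eq (bead_seq k mu) ([seq bead k mu i | i <- iota 0 (size mu)] ++ iota 0 (k - size mu)).
Proof.
move=> le_k; rewrite /bead_seq -{2}(subnKC le_k) iotaD map_cat perm_cat2l add0n.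
have -> : [seq bead k mu i | i <- iota (size mu) (k - size mu)] = rev (iota 0 (k - size mu)).
  apply: (@eq_from_nth _ 0%N) => [|i]; rewrite size_map size_iota ?size_rev ?size_iota // => lt_i.
  rewrite (nth_map 0%N) ?size_iota // nth_rev ?size_iota // !nth_iota //; last by lia.
  by rewrite /bead nth_default ?leq_addr //; lia.
by rewrite perm_rev.
Qed.

Definition tilde_poly (k : nat) (kappa : seq nat) : {poly rat} :=
  root_poly (bead_seq k (tilde_part k kappa)).

Definition shifted_schur_entry (k : nat) (kappa la : seq nat) (a j : nat) : rat :=
  res_inf (tilde_poly k kappa) k ('X^a * root_poly (iota 0 (bead k la j))).

(* The shifted Schur function of [la] at the tilde of [kappa]. *)
Definition shifted_schur (k : nat) (kappa la : seq nat) : rat :=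
  \det (\matrix_(a < size la, j < size la) shifted_schur_entry k kappa la a j).

Lemma size_tilde_poly k kappa : size (tilde_poly k kappa) = k.+1.
Proof. by rewrite size_root_poly size_bead_seq. Qed.

(** [det_eval_ratio] compares with the empty partition. From column [size la] on, both partitions
    have the same falling factorials, so [det_ulblock] cuts the residue determinant down to size
    [size la]. *)
Lemma det_bead_tilde k kappa la : (size la <= k)%N ->
  \det (bead_mx rat k (tilde_part k kappa) la) =
  \det (bead_mx rat k (tilde_part k kappa) [::]) * shifted_schur k kappa la.
Proof.
move=> le_k.
have bead_mxE nu : bead_mx rat k (tilde_part k kappa) nu =
    \matrix_(i, j) (root_poly (iota 0 (bead k nu j))).[(bead k (tilde_part k kappa) i)%:R].
  by apply/matrixP => i j; rewrite !mxE horner_root_poly_iota.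
have root_bead (i : 'I_k) : root (tilde_poly k kappa) (bead k (tilde_part k kappa) i)%:R.
  rewrite /tilde_poly /root_poly /bead_seq !big_map -[X in iota 0 X]subn0 -/(index_iota 0 k).
  by rewrite big_mkord /root horner_prod (bigD1 i) //= hornerXsubC subrr mul0r.
have size_Xf nu a (j : 'I_k) : (size nu <= j)%N ->
    size ('X^a * root_poly (iota 0 (bead k nu j))) = (a + (k - j))%N.
  move=> le_j; rewrite mulrC size_mulXn ?monic_neq0 ?root_poly_monic //.
  by rewrite size_root_poly size_iota /bead nth_default //; have := ltn_ord j; lia.
rewrite [in LHS]bead_mxE (@det_eval_ratio _ _ _ (size_tilde_poly k kappa)
  (fun i => (bead k (tilde_part k kappa) i)%:R) (fun j => root_poly (iota 0 (bead k la j)))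
  (fun j => root_poly (iota 0 (bead k [::] j))) root_bead); first last.
- by move=> j; have := size_Xf [::] 0%N j (leq0n _); rewrite expr0 mul1r.
- by move=> j; exact: root_poly_monic.
rewrite -bead_mxE; congr (_ * _).
apply: (det_ulblock (M := shifted_schur_entry k kappa la)) => // [a j|j] /andP[le_j lt_j].
  move=> lt_aj; rewrite /shifted_schur_entry res_inf_small ?size_tilde_poly //.
  by rewrite (size_Xf la a (Ordinal lt_j)) //=; lia.
rewrite /shifted_schur_entry res_inf_monic ?size_tilde_poly //.
  by rewrite monicMl ?monicXn ?root_poly_monic.
by rewrite (size_Xf la j (Ordinal lt_j)) //= subnKC // ltnW.
Qed.

(** Quotient of Aitken's formula for [la] by that for the empty partition: the factorials of the
    beads cancel, and the two leading factorials leave the falling factorial. *)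
Lemma dim_tilde_shifted_schur k kappa la : is_part kappa -> is_part la ->
  fits_square k kappa -> fits_square k la -> (sumn kappa + sumn la <= k ^ 2)%N ->
  (dim_part la (tilde_part k kappa))%:R * ((k ^ 2 - sumn kappa) ^_ (sumn la))%:R =
  (dim_part [::] (tilde_part k kappa))%:R * shifted_schur k kappa la.
Proof.
move=> pka pla fka fla le_N.
have pt := tilde_is_part k pka; have ft := tilde_fits k pka.
have sum_t := sumn_tilde pka fka.
have [size_t _] := andP ft; have [size_la _] := andP fla.
have := dim_part_det (m := (k ^ 2 - sumn kappa - sumn la)%N) pt pla size_t size_la.
have := dim_part_det (m := (k ^ 2 - sumn kappa)%N) (la := [::]) pt isT size_t (leq0n _).
rewrite (@det_bead_tilde k kappa la) //=; set P := \prod_(i < k) _ =>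
  /(_ ltac:(lia)) dim0 /(_ ltac:(lia)) dim_la.
have P_neq0 : P != 0 by apply/prodf_neq0 => i _; rewrite pnatr_eq0 -lt0n fact_gt0.
apply: (mulIf P_neq0); rewrite mulrAC dim_la [RHS]mulrAC dim0.
rewrite -[X in _ = X%:R * _ * _](@ffact_fact _ (sumn la)) ?natrM; last by lia.
by ring.
Qed.

Lemma coef_poly_on_ext K P R : (forall k, (K <= k)%N -> P k = R k) ->
  coef_poly_on K P -> coef_poly_on K R.
Proof. by move=> eq_PR PP s; apply: poly_on_ext (PP s) => k le_k; rewrite eq_PR. Qed.

(** * Polynomiality of the shifted Schur determinant in the side *)

Section Polynomiality.

Variables (kappa la : seq nat) (K : nat).
Hypotheses (pka : is_part kappa) (K_gt0 : (0 < K)%N) (fka : fits_square K kappa).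
Hypothesis size_la : (size la <= K)%N.

Let fits k : (K <= k)%N -> fits_square k kappa.
Proof. by move=> le_k; case/andP: fka => ? ?; rewrite /fits_square !(leq_trans _ le_k). Qed.

Let natr_bead mu i k : (i < k)%N ->
  (bead k mu i)%:R = 1 * k%:R + ((nth 0%N mu i)%:R - i.+1%:R) :> rat.
Proof. by move=> lt_i; rewrite natrD natrB //; ring. Qed.

Lemma coef_poly_on_bead_seq : coef_poly_on K (fun k => rev_root_poly (bead_seq k kappa)).
Proof.
have [size_ka _] := andP fka.
apply: (@coef_poly_on_ext _ (fun k => (\prod_(i < size kappa) (1 - (bead k kappa i)%:R *: 'X)) *
    rev_root_poly (iota 0 (k - size kappa)))) => [k le_k|].
  have le_ka := leq_trans size_ka le_k.
  rewrite (rev_root_poly_perm (perm_bead_seq le_ka)) rev_root_poly_cat; congr (_ * _).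
  by rewrite /rev_root_poly big_map -[X in iota 0 X]subn0 -/(index_iota 0 (size kappa)) big_mkord.
apply: coef_poly_onM.
  apply: coef_poly_on_prod => i; apply: coef_poly_on_linear => k le_k; apply: natr_bead.
  exact: leq_trans (ltn_ord i) (leq_trans size_ka le_k).
apply: (@coef_poly_on_iota_comp _ _ 1 (- (size kappa)%:R)) => k le_k.
by rewrite natrB ?mul1r // (leq_trans size_ka).
Qed.

Let w k s : rat := res_inf (tilde_poly k kappa) k 'X^(k.-1 + s).

(** The beads of [kappa] and of its tilde together are [0, ..., 2k - 1], and the [w k s] are the
    coefficients of the inverse of the tilde factor. Their series is thus the reversed polynomial of
    the beads of [kappa] divided by that of the whole interval. *)
Lemma poly_on_res_inf s : poly_on K (2 * s) (w^~ s).
Proof.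
apply: (poly_on_quotient (T := fun k => rev_root_poly (iota 0 (k + k))) _ coef_poly_on_bead_seq).
- by apply: (@coef_poly_on_iota_comp _ _ 2 0) => k _; rewrite natrD; ring.
- by move=> k; exact: rev_root_poly0.
move=> k {}s le_k; pose W : {poly rat} := \poly_(i < s.+1) w k i.
have W_coef i : (i <= s)%N -> W`_i = w k i by move=> le_i; rewrite coef_poly ltnS le_i.
transitivity ((rev_root_poly (iota 0 (k + k)) * W)`_s).
  by rewrite coefM; apply: eq_bigr => j _; rewrite W_coef ?leq_subr.
rewrite -(rev_root_poly_perm (perm_bead_tilde pka (fits le_k))) rev_root_poly_cat.
rewrite [X in X * W]mulrC -mulrA coefM.
have inv n : (n <= s)%N -> (rev_root_poly (bead_seq k (tilde_part k kappa)) * W)`_n = (n == 0%N)%:R.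
  move=> le_n; apply: (rev_root_poly_inv (size_bead_seq k _)); first exact: leq_trans le_k.
  by move=> i le_i; apply: W_coef; exact: leq_trans le_n.
rewrite big_ord_recr /= big1 ?add0r; first by rewrite subnn inv // mulr1.
by move=> j _; have lt_j := ltn_ord j; rewrite inv ?leq_subr // subn_eq0 leqNgt lt_j mulr0.
Qed.

Lemma shifted_schur_entry_eq0 a j k : (j < size la)%N -> (a + nth 0%N la j < j)%N -> (K <= k)%N ->
  shifted_schur_entry k kappa la a j = 0.
Proof.
move=> lt_j lt_a le_k; rewrite /shifted_schur_entry res_inf_small ?size_tilde_poly //.
rewrite mulrC size_mulXn ?monic_neq0 ?root_poly_monic // size_root_poly size_iota /bead.
lia.
Qed.

(** The polynomial in the entry has degree [k - 1 + n] with [n = a + la_j - j], so its residue only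
    involves [w] up to order [n], and the grading gives degree [2 n]. *)
Lemma poly_on_shifted_schur_entry a j : (j < size la)%N -> (j <= a + nth 0%N la j)%N ->
  poly_on K (2 * (a + nth 0%N la j - j)) (fun k => shifted_schur_entry k kappa la a j).
Proof.
move=> lt_j le_j; set n := (_ - j)%N.
have: poly_on K (2 * n) (fun k =>
    \sum_(r < n.+1) (rev_root_poly (iota 0 (bead k la j)))`_r * w k (n - r)%N).
  apply: poly_on_sum => r; have lt_r := ltn_ord r.
  rewrite (_ : 2 * n = 2 * r + 2 * (n - r))%N; last by lia.
  apply: poly_onM (poly_on_res_inf _).
  apply: (coef_poly_on_iota_comp (h := fun k => bead k la j)) => k le_k; apply: natr_bead.
  exact: leq_trans lt_j (leq_trans size_la le_k).
apply: poly_on_ext => k le_k; pose W : {poly rat} := \poly_(i < n.+1) w k i.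
have W_coef i : (i <= n)%N -> W`_i = w k i by move=> le_i; rewrite coef_poly ltnS le_i.
rewrite /shifted_schur_entry (res_inf_root_poly (size_tilde_poly k kappa) _ W_coef).
- by rewrite coefM; apply: eq_bigr => r _; rewrite W_coef ?leq_subr.
- exact: leq_trans le_k.
by rewrite size_iota /bead /n; lia.
Qed.

Lemma poly_on_shifted_schur : poly_on K (2 * sumn la) (fun k => shifted_schur k kappa la).
Proof.
apply: poly_on_sum => s; apply: poly_onZ.
(* Truncated subtraction in the degree bound is faithful only if [s i <= i + la_(s i)] for every
   [i]; otherwise the term has a zero factor. In the faithful case the shifts [i - s i] cancel over
   the permutation. *)
have [/forallP le_s|] := boolP [forall i : 'I_(size la), s i <= i + nth 0%N la (s i)]%N; last first.
  rewrite negb_forall => /existsP[i]; rewrite -ltnNge => lt_i.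
  apply: poly_on_ext (poly_on0 _ _) => k le_k; rewrite (bigD1 i) //= mxE.
  by rewrite shifted_schur_entry_eq0 ?mul0r.
rewrite (_ : 2 * sumn la = \sum_(i < size la) 2 * (i + nth 0 la (s i) - s i))%N; last first.
  rewrite -big_distrr /=; congr (2 * _)%N; rewrite (sumn_nth (leqnn _)).
  have sum_s (F : 'I_(size la) -> nat) : (\sum_i F (s i) = \sum_i F i)%N.
    by rewrite [RHS](reindex s) //; exists (s^-1)%g => i _; rewrite ?permK ?permKV.
  apply: (@addIn (\sum_(i < size la) s i)%N); rewrite -[RHS]big_split /=.
  under [RHS]eq_bigr => i _ do rewrite subnK ?le_s //.
  rewrite [RHS]big_split /= (sum_s (fun i => nth 0%N la i)) (sum_s (fun i => i : nat)).
  exact: addnC.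
apply: (@poly_on_ext _ _ (fun k => \prod_(i < size la) shifted_schur_entry k kappa la i (s i))).
  by move=> k _; apply: eq_bigr => i _; rewrite mxE.
by apply: poly_on_prod => i; apply: poly_on_shifted_schur_entry.
Qed.

End Polynomiality.

(** * The number of paths to the full square *)

Lemma bead_tilde_nil k i : (i < k)%N -> bead k (tilde_part k [::]) i = (k - i.+1 + k)%N.
Proof.
move=> lt_i; rewrite /bead addnC; congr (_ + _)%N; apply: eq_from_lt => r.
by rewrite lt_nth_tilde // nth_nil subn0 lt_i andbT.
Qed.

(** Vandermonde's convolution for ['C(k - i.+1 + k, k - j.+1)] factors the matrix: [L] is upper
    unitriangular, and [U] is lower triangular with the factorials on its diagonal. *)
Lemma det_bead_square k :
  \det (bead_mx rat k (tilde_part k [::]) [::]) = \prod_(j < k) ((k - j.+1)`!)%:R.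
Proof.
pose L : 'M[rat]_k := \matrix_(i, r) 'C(k - i.+1, k - r.+1)%:R.
pose U : 'M[rat]_k := \matrix_(r, j)
  (if (j <= r)%N then ('C(k, (k - j.+1) - (k - r.+1)) * (k - j.+1)`!)%:R else 0).
have -> : bead_mx rat k (tilde_part k [::]) [::] = L *m U.
  apply/matrixP => i j; rewrite !mxE bead_tilde_nil // /bead nth_nil add0n.
  have lt_j := ltn_ord j; set m := (k - j.+1)%N.
  rewrite -bin_ffact natrM -binomial.Vandermonde natr_sum mulr_suml.
  pose F r : rat := if (r <= m)%N then ('C(k - i.+1, r) * 'C(k, m - r))%:R * (m`!)%:R else 0.
  transitivity (\sum_(r < m.+1) F r).
    by apply: eq_bigr => r _; rewrite /F -ltnS ltn_ord.
  rewrite (sum_ord_widen (n := k)); first last.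
  - by move=> r lt_r; rewrite /F leqNgt lt_r.
  - by rewrite /m; lia.
  rewrite (reindex_inj rev_ord_inj); apply: eq_bigr => r _; rewrite !mxE /F /=.
  have lt_r := ltn_ord r.
  rewrite (_ : (k - r.+1 <= m)%N = (j <= r)%N); last by rewrite /m; lia.
  by case: ifP; rewrite ?mulr0 // !natrM mulrA.
rewrite det_mulmx -[\det L]det_tr !det_trig.
- rewrite big1 ?mul1r => [|i _]; last by rewrite !mxE binn.
  by apply: eq_bigr => j _; rewrite mxE leqnn subnn bin0 mul1n.
- by apply/is_trig_mxP => i j lt_ij; rewrite mxE leqNgt lt_ij.
apply/is_trig_mxP => i j lt_ij; rewrite !mxE bin_small //.
by have := ltn_ord j; lia.
Qed.

(** The determinant supplies the [j!], and the beads [k, ..., 2k - 1] of the square supply the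
    [(j + k)!]. *)
Lemma dim_square k : (dim_part [::] (tilde_part k [::]))%:R = g_square k.
Proof.
have fnil : fits_square k [::] by [].
have := dim_part_det (la := [::]) (m := (k ^ 2)%N) (tilde_is_part k (isT : is_part [::])) isT
  (proj1 (andP (tilde_fits k (isT : is_part [::])))) (leq0n _).
have := sumn_tilde (isT : is_part [::]) fnil; rewrite addn0 => -> /(_ erefl).
rewrite det_bead_square /g_square big_mkord => dimE.
have prod_fact : \prod_(i < k) ((bead k (tilde_part k [::]) i)`!)%:R =
    \prod_(j < k) ((j + k)`!)%:R :> rat.
  rewrite [RHS](reindex_inj rev_ord_inj); apply: eq_bigr => i _ /=.
  by rewrite bead_tilde_nil.
have neq0 : \prod_(j < k) ((j + k)`!)%:R != 0 :> rat.
  by apply/prodf_neq0 => i _; rewrite pnatr_eq0 -lt0n fact_gt0.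
rewrite prod_fact in dimE; rewrite prodf_div mulrA; apply: (canRL (mulfK neq0)).
by rewrite dimE; congr (_ * _); rewrite [RHS](reindex_inj rev_ord_inj).
Qed.

Lemma prod_sqr_sub (k N : nat) :
  \prod_(0 <= i < N) (k%:R ^+ 2 - i%:R) = ((k ^ 2) ^_ N)%:R :> rat.
Proof.
rewrite -horner_root_poly_iota /root_poly horner_prod natrX /index_iota subn0.
by apply: eq_bigr => i _; rewrite hornerXsubC.
Qed.

Lemma ffactD n a b : (n ^_ (a + b) = n ^_ a * (n - a) ^_ b)%N.
Proof.
by elim: b => [|b IHb]; rewrite ?addn0 ?muln1 // addnS !ffactnSr IHb subnDA mulnA.
Qed.

Theorem theorem1p4 (kappa lambda : seq nat)
    (hkappa : is_part kappa) (hlambda : is_part lambda) :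
  let N := (sumn kappa + sumn lambda)%N in
  exists B : {poly rat},
    (size B <= (2 * N).+1)%N /\
    forall k : nat, (1 <= k)%N ->
      fits_square k kappa -> fits_square k lambda -> (N <= k ^ 2)%N ->
      dim_part lambda (tilde_part k kappa) =
        dim_part kappa (tilde_part k lambda) /\
      (dim_part kappa (tilde_part k lambda))%:R =
        g_square k * B.[k%:R] / \prod_(0 <= i < N) (k%:R ^+ 2 - i%:R) :> rat.
Proof.
(* Every positive [k] for which both partitions fit is at least [K], so polynomiality from [K] on
   covers each [k] concerned. *)
move=> N; pose K := maxn 1 (maxn (maxn (size kappa) (head 0%N kappa)) (size lambda)).
have K_gt0 : (0 < K)%N by rewrite leq_max.
have fka : fits_square K kappa by rewrite /fits_square /K !leq_max !leqnn ?orbT.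
have size_la : (size lambda <= K)%N by rewrite /K !leq_max leqnn !orbT.
have [size_ka _] := andP fka.
(* [B] is the product of the shifted Schur function of [lambda] at the tilde of [kappa] and that of
   [kappa] at the square, the tilde of the empty partition. *)
have [B size_B B_eq] := poly_onM (poly_on_shifted_schur hkappa K_gt0 fka size_la)
  (poly_on_shifted_schur (isT : is_part [::]) K_gt0 (isT : fits_square K [::]) size_ka).
exists B; split=> [|k k_gt0 fk_ka fk_la le_N]; first by rewrite mulnDr addnC.
have sym := dim_tilde_sym hkappa hlambda fk_ka fk_la; split=> //.
have le_K : (K <= k)%N.
  by rewrite /K !geq_max k_gt0; case/andP: fk_ka => -> ->; case/andP: fk_la => ->.
(* The denominator splits into falling factorials of [k ^ 2] and of [k ^ 2 - |kappa|], one for each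
   of the two ratios. *)
rewrite -sym prod_sqr_sub ffactD natrM -B_eq //.
have dim_la := dim_tilde_shifted_schur hkappa hlambda fk_ka fk_la le_N.
have le_ka : (sumn [::] + sumn kappa <= k ^ 2)%N by rewrite (leq_trans _ le_N) ?leq_addr.
have := dim_tilde_shifted_schur (isT : is_part [::]) hkappa (isT : fits_square k [::]) fk_ka le_ka.
(* By symmetry the dimension from [kappa] to the square is the dimension from the empty partition to
   the tilde of [kappa], which is the factor left over in [dim_la]. *)
rewrite subn0 dim_square -(dim_tilde_sym hkappa (isT : is_part [::]) fk_ka isT) => dim_ka.
have neq0 n m : (m <= n)%N -> (n ^_ m)%:R != 0 :> rat by rewrite pnatr_eq0 -lt0n ffact_gt0.
rewrite -/N in le_N; have ka_neq0 := neq0 _ _ (leq_trans (leq_addr _ _) le_N : sumn kappa <= k ^ 2)%N.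
have la_neq0 := neq0 (k ^ 2 - sumn kappa)%N (sumn lambda) ltac:(rewrite /N in le_N; lia).
apply: (canRL (mulfK _)); first by rewrite mulf_neq0.
by rewrite mulrCA dim_la mulrCA mulrA dim_ka; ring.
Qed.
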